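(* For $0<p<1$ let $\Delta_p\subset\mathbf R^2$ be the quadrilateral with vertices $(0,0),(p,0),(p,1-p),(0,1)$, let $U_p=\{(a,b,c): a\mu_1+b\mu_2+c>0 \text{ on }\Delta_p\}$, and let $$E_p(a,b,c)=8\pi^2\,\frac{\left(\int_{\partial\Delta_p}(a\mu_1+b\mu_2+c)^{-2}\,d\sigma\right)^2}{\int_{\Delta_p}(a\mu_1+b\mu_2+c)^{-4}\,d\mu}$$ on $U_p/\mathbf R_+$. Then: (i) for every $0<p<1$, $\left[\left(1,0,\frac{p(1-\sqrt{1-p})}{2\sqrt{1-p}+p-2}\right)\right]$ is a critical point of $E_p$; (ii) for $\frac89<p<1$, the two points $\left[\left(-1,0,\frac{p(3p\pm\sqrt{9p^2-8p})}{2(p\pm\sqrt{9p^2-8p})}\right)\right]$ are also critical points of $E_p$; (iii) letting $0<\alpha<\beta<1$ be the real roots of $F(p)=p^4-4p^3+16p^2-16p+4$, for $0<p<\alpha$ the two points $\left[\left(p^2-4p+2\pm\sqrt{F(p)},\,\pm2\sqrt{F(p)},\,p^2+2p-2\mp\sqrt{F(p)}\right)\right]$ are also critical points of $E_p$.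
   Context: $d\mu$ is Lebesgue measure on $\Delta_p$ and $d\sigma$ is the standard boundary measure for a Delzant polytope (on each facet, $d\mu = d\sigma\wedge d\ell$ where $\ell$ is the affine function defining the facet with primitive integral inward normal). $E_p$ is invariant under positive scaling of $(a,b,c)$ and is the square of the normalized Einstein–Hilbert functional of the conformal metric $f^{-2}g$ on the toric one-point blow-up of $\mathbf{CP}^2$ with moment polytope $\Delta_p$ and $f=a\mu_1+b\mu_2+c$. *)

(* Defs.v *)
From Stdlib Require Import Reals Lra ClassicalEpsilon.
Open Scope R_scope.

(* Riemann integral of f over [a,b], made total: 0 if f is not Riemann
   integrable there.  Uses the classical (whitelisted) choice axioms. *)
Definition Rint (f : R -> R) (a b : R) : R :=
  match excluded_middle_informative (inhabited (Riemann_integrable f a b)) with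
  | left h => RiemannInt (epsilon h (fun _ => True))
  | right _ => 0
  end.

Definition inDelta (p x y : R) : Prop :=
  0 <= x <= p /\ 0 <= y /\ x + y <= 1.

Definition afff (a b c x y : R) : R := a * x + b * y + c.

Definition intDelta (p : R) (g : R -> R -> R) : R :=
  Rint (fun x => Rint (fun y => g x y) 0 (1 - x)) 0 p.

(* Integral over the boundary w.r.t. the standard Delzant boundary measure
   d sigma (d mu = d sigma /\ d l on each facet, l the defining affine
   function with primitive inward normal).  Facets:
     y = 0   (l = y,       d sigma = dx, x in [0,p]),
     x = p   (l = p - x,   d sigma = dy, y in [0,1-p]),
     x + y = 1 (l = 1-x-y, d sigma = dx, x in [0,p]),
     x = 0   (l = x,       d sigma = dy, y in [0,1]). *)
Definition intBoundary (p : R) (g : R -> R -> R) : R :=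
  Rint (fun x => g x 0) 0 p
  + Rint (fun y => g p y) 0 (1 - p)
  + Rint (fun x => g x (1 - x)) 0 p
  + Rint (fun y => g 0 y) 0 1.

Definition Ep (p a b c : R) : R :=
  8 * PI ^ 2 *
  (intBoundary p (fun x y => / (afff a b c x y) ^ 2)) ^ 2
  / intDelta p (fun x y => / (afff a b c x y) ^ 4).

(* (a,b,c) gives an admissible class: f does not vanish on Delta_p,
   i.e. (a,b,c) or -(a,b,c) lies in U_p (Delta_p is connected). *)
Definition admissible (p a b c : R) : Prop :=
  forall x y, inDelta p x y -> afff a b c x y <> 0.

Definition critical_point (p a b c : R) : Prop :=
  admissible p a b c /\
  forall u v w : R,
    derivable_pt_lim (fun t => Ep p (a + t * u) (b + t * v) (c + t * w)) 0 0.

Definition Fpoly (p : R) : R := p ^ 4 - 4 * p ^ 3 + 16 * p ^ 2 - 16 * p + 4.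

(* Main.v *)
(* An affine f is determined by its values f0, f1, f2, f3 at the vertices
   (0,0), (p,0), (p,1-p), (0,1) of Delta_p, and both integrals in E_p are
   rational in them: an edge of lattice length L joining vertices i and j
   contributes L / (f_i f_j) to the boundary integral, and the area integral
   is the sum over the two triangles of the diagonal (0,0)-(p,1-p).  Near an
   admissible point, E_p = 8 pi^2 B^2 / A, so its derivative in a direction
   is proportional to 2 A B' - B A'.  Because B and A are homogeneous of
   degrees -2 and -4, this expression vanishes in the radial direction, so
   only the directions mu1 and mu2 have to be checked.  For the first two
   families this is a field identity; for the third, f0 f3 = 8p(1-p)^2 and
   f1 f2 = 8p(1-p)^3 turn every 1/f_i into a polynomial, and the identity
   then holds modulo r^2 = F(p). *)

Require Import Defs.
From Stdlib Require Import Reals Lra ClassicalEpsilon.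
From Coquelicot Require Import Coquelicot.
Open Scope R_scope.
Set Bullet Behavior "Strict Subproofs".

Ltac neq0 :=
  repeat match goal with
  | |- _ * _ <> 0 => apply Rmult_integral_contrapositive_currified
  | |- _ ^ _ <> 0 => apply pow_nonzero
  end; auto; try lra.

Lemma Rint_antiderivative (f g G : R -> R) (a b : R) : a <= b ->
  (forall x, a <= x <= b -> f x = g x) ->
  (forall x, a <= x <= b -> is_derive G x (g x)) ->
  (forall x, a <= x <= b -> continuous g x) ->
  Rint f a b = G b - G a.
Proof.
intros hab hfg hG hg.
assert (hI : is_RInt f a b (G b - G a)).
{ apply (is_RInt_ext g).
  - rewrite Rmin_left, Rmax_right by lra. intros x hx. symmetry. apply hfg. lra.
  - apply (is_RInt_derive G g); rewrite Rmin_left, Rmax_right by lra; assumption. }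
unfold Rint. destruct (excluded_middle_informative _) as [hinh | hnot].
- rewrite <- RInt_Reals. exact (is_RInt_unique _ _ _ _ hI).
- exfalso. apply hnot. constructor. apply ex_RInt_Reals_0. exists (G b - G a). exact hI.
Qed.

Lemma Rint_inv_sqr_affine (f : R -> R) (al be L : R) : 0 <= L ->
  (forall t, 0 <= t <= L -> al * t + be <> 0) ->
  (forall t, f t = / (al * t + be) ^ 2) ->
  Rint f 0 L = L / (be * (al * L + be)).
Proof.
intros hL hnz hf.
assert (hbe : be <> 0) by (replace be with (al * 0 + be) by ring; apply hnz; lra).
rewrite (Rint_antiderivative f (fun t => / (al * t + be) ^ 2) (fun t => t / (be * (al * t + be))));
  auto.
- field. split; [apply hnz; lra | exact hbe].
- intros x hx. specialize (hnz x hx). auto_derive; [auto | field; auto].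
- intros x hx. specialize (hnz x hx).
  apply (ex_derive_continuous (K := R_AbsRing) (V := R_NormedModule)). auto_derive. neq0.
Qed.

Lemma Rint_inv_pow4_affine (f : R -> R) (al be L : R) : 0 <= L ->
  (forall t, 0 <= t <= L -> al * t + be <> 0) ->
  (forall t, f t = / (al * t + be) ^ 4) ->
  Rint f 0 L = L * (be ^ 2 + be * (al * L + be) + (al * L + be) ^ 2)
                 / (3 * be ^ 3 * (al * L + be) ^ 3).
Proof.
intros hL hnz hf.
assert (hbe : be <> 0) by (replace be with (al * 0 + be) by ring; apply hnz; lra).
rewrite (Rint_antiderivative f (fun t => / (al * t + be) ^ 4)
  (fun t => t * (be ^ 2 + be * (al * t + be) + (al * t + be) ^ 2)
              / (3 * be ^ 3 * (al * t + be) ^ 3))); auto.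
- field. split; [apply hnz; lra | exact hbe].
- intros x hx. specialize (hnz x hx). auto_derive; [neq0 | field; auto].
- intros x hx. specialize (hnz x hx).
  apply (ex_derive_continuous (K := R_AbsRing) (V := R_NormedModule)). auto_derive. neq0.
Qed.

Definition vtx0 (a b c : R) := afff a b c 0 0.
Definition vtx1 (p a b c : R) := afff a b c p 0.
Definition vtx2 (p a b c : R) := afff a b c p (1 - p).
Definition vtx3 (a b c : R) := afff a b c 0 1.

Definition bdry_form (p f0 f1 f2 f3 : R) :=
  p * / f0 * / f1 + (1 - p) * / f1 * / f2 + p * / f2 * / f3 + / f3 * / f0.

(* The integral of f^-4 over a triangle on whose vertices f takes the values
   x, y, z is (area / 3) * tri_form x y z; Delta_p is cut along the diagonal
   from (0,0) to (p,1-p) into triangles of areas p(1-p)/2 and p/2. *)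
Definition tri_form (x y z : R) := (/ x + / y + / z) * / x * / y * / z.

Definition area_form (p f0 f1 f2 f3 : R) :=
  p * (1 - p) / 6 * tri_form f0 f1 f2 + p / 6 * tri_form f0 f2 f3.

Ltac apply_admissible hadm x y :=
  lazymatch type of hadm with
  | admissible _ ?a ?b ?c =>
    lazymatch goal with
    | |- ?e <> 0 =>
      replace e with (afff a b c x y) by (unfold afff; ring); apply hadm; red; lra
    end
  end.

Lemma intBoundary_vertex_form p a b c : 0 < p < 1 -> admissible p a b c ->
  intBoundary p (fun x y => / afff a b c x y ^ 2)
  = bdry_form p (vtx0 a b c) (vtx1 p a b c) (vtx2 p a b c) (vtx3 a b c).
Proof.
intros hp hadm. unfold intBoundary.
rewrite (Rint_inv_sqr_affine _ a c p), (Rint_inv_sqr_affine _ b (a * p + c) (1 - p)),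
  (Rint_inv_sqr_affine _ (a - b) (b + c) p), (Rint_inv_sqr_affine _ b c 1);
  try lra; try (intro t; unfold afff; f_equal; ring).
- unfold bdry_form, vtx0, vtx1, vtx2, vtx3, afff. field.
  repeat split; [apply_admissible hadm 0 0 | apply_admissible hadm 0 1
                | apply_admissible hadm p (1 - p) | apply_admissible hadm p 0].
- intros t ht. apply_admissible hadm 0 t.
- intros t ht. apply_admissible hadm t (1 - t).
- intros t ht. apply_admissible hadm p t.
- intros t ht. apply_admissible hadm t 0.
Qed.

Lemma intDelta_vertex_form p a b c : 0 < p < 1 -> admissible p a b c ->
  intDelta p (fun x y => / afff a b c x y ^ 4)
  = area_form p (vtx0 a b c) (vtx1 p a b c) (vtx2 p a b c) (vtx3 a b c).
Proof.
intros hp hadm. unfold intDelta.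
(* The area integral over Delta_X, as a function of X, is an antiderivative
   of the inner integral. *)
rewrite (Rint_antiderivative _
  (fun x => (1 - x) * ((a * x + c) ^ 2 + (a * x + c) * (b * (1 - x) + (a * x + c))
                       + (b * (1 - x) + (a * x + c)) ^ 2)
            / (3 * (a * x + c) ^ 3 * (b * (1 - x) + (a * x + c)) ^ 3))
  (fun X => area_form X (vtx0 a b c) (vtx1 X a b c) (vtx2 X a b c) (vtx3 a b c)));
  try lra.
- unfold area_form, Rdiv. ring.
- intros x hx. apply Rint_inv_pow4_affine; [lra | | intro y; unfold afff; f_equal; ring].
  intros y hy. apply_admissible hadm x y.
- intros x hx. unfold area_form, tri_form, vtx0, vtx1, vtx2, vtx3, afff.
  auto_derive; [| field]; repeat split;
    first [ apply_admissible hadm x 0 | apply_admissible hadm x (1 - x)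
          | apply_admissible hadm 0 0 | apply_admissible hadm 0 1 ].
- intros x hx.
  apply (ex_derive_continuous (K := R_AbsRing) (V := R_NormedModule)). auto_derive.
  repeat split; neq0; first [ apply_admissible hadm x 0 | apply_admissible hadm x (1 - x) ].
Qed.

Lemma Ep_vertex_form p a b c : 0 < p < 1 -> admissible p a b c ->
  Ep p a b c = 8 * PI ^ 2
    * bdry_form p (vtx0 a b c) (vtx1 p a b c) (vtx2 p a b c) (vtx3 a b c) ^ 2
    / area_form p (vtx0 a b c) (vtx1 p a b c) (vtx2 p a b c) (vtx3 a b c).
Proof.
intros hp hadm. unfold Ep. rewrite intBoundary_vertex_form, intDelta_vertex_form; auto.
Qed.

Definition vertices_pos (p a b c : R) :=
  0 < vtx0 a b c /\ 0 < vtx1 p a b c /\ 0 < vtx2 p a b c /\ 0 < vtx3 a b c.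

Definition vertices_same_sign (p a b c : R) :=
  vertices_pos p a b c \/ vertices_pos p (- a) (- b) (- c).

Lemma convex_comb_pos (s t u v : R) :
  0 <= s -> 0 <= t -> 0 < s + t -> 0 < u -> 0 < v -> 0 < s * u + t * v.
Proof.
intros hs ht hst hu hv.
destruct (Req_dec s 0) as [-> | hs0].
- rewrite Rmult_0_l, Rplus_0_l. apply Rmult_lt_0_compat; lra.
- assert (0 < s * u) by (apply Rmult_lt_0_compat; lra).
  assert (0 <= t * v) by (apply Rmult_le_pos; lra).
  lra.
Qed.

Lemma afff_pos_of_vertices_pos p a b c x y : 0 < p < 1 ->
  vertices_pos p a b c -> inDelta p x y -> 0 < afff a b c x y.
Proof.
unfold vertices_pos, vtx0, vtx1, vtx2, vtx3, inDelta.
intros hp [h0 [h1 [h2 h3]]] [[hx0 hxp] [hy0 hxy]].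
(* Bilinear interpolation of the vertex values. *)
assert (interp : p * (1 - x) * afff a b c x y
  = (1 - x - y) * ((p - x) * afff a b c 0 0 + x * afff a b c p 0)
    + y * ((p - x) * afff a b c 0 1 + x * afff a b c p (1 - p)))
  by (unfold afff; ring).
assert (hw : 0 < p * (1 - x)) by nra.
assert (0 < p * (1 - x) * afff a b c x y).
{ rewrite interp. apply convex_comb_pos; try lra; apply convex_comb_pos; lra. }
nra.
Qed.

Lemma afff_opp a b c x y : afff (- a) (- b) (- c) x y = - afff a b c x y.
Proof. unfold afff. ring. Qed.

Lemma admissible_of_same_sign p a b c : 0 < p < 1 ->
  vertices_same_sign p a b c -> admissible p a b c.
Proof.
intros hp [hpos | hneg] x y hxy.
- generalize (afff_pos_of_vertices_pos p a b c x y hp hpos hxy). lra.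
- generalize (afff_pos_of_vertices_pos p _ _ _ x y hp hneg hxy).
  rewrite afff_opp. lra.
Qed.

Lemma locally_pos_of_continuity (f : R -> R) (x : R) :
  continuity_pt f x -> 0 < f x -> locally x (fun t => 0 < f t).
Proof.
intros hf hpos.
apply (filter_imp (fun t => Rabs (f t - f x) < f x)).
- intros t ht. apply Rabs_def2 in ht. lra.
- exact (proj1 (continuity_pt_locally f x) hf (mkposreal _ hpos)).
Qed.

Lemma vertices_pos_near p a b c u v w : vertices_pos p a b c ->
  locally 0 (fun t => vertices_pos p (a + t * u) (b + t * v) (c + t * w)).
Proof.
unfold vertices_pos, vtx0, vtx1, vtx2, vtx3, afff. intros [h0 [h1 [h2 h3]]].
repeat apply filter_and; apply locally_pos_of_continuity;
  try (reg; fail); rewrite ?Rmult_0_l, ?Rplus_0_r; assumption.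
Qed.

Lemma tri_form_pos x y z : 0 < x -> 0 < y -> 0 < z -> 0 < tri_form x y z.
Proof.
intros hx hy hz. unfold tri_form.
pose proof (Rinv_0_lt_compat x hx). pose proof (Rinv_0_lt_compat y hy).
pose proof (Rinv_0_lt_compat z hz).
repeat apply Rmult_lt_0_compat; lra.
Qed.

Lemma area_form_opp p f0 f1 f2 f3 :
  area_form p (- f0) (- f1) (- f2) (- f3) = area_form p f0 f1 f2 f3.
Proof. unfold area_form, tri_form. rewrite !Rinv_opp. ring. Qed.

Lemma area_form_pos p a b c : 0 < p < 1 -> vertices_same_sign p a b c ->
  0 < area_form p (vtx0 a b c) (vtx1 p a b c) (vtx2 p a b c) (vtx3 a b c).
Proof.
intros hp hs.
assert (hpos : forall f0 f1 f2 f3, 0 < f0 -> 0 < f1 -> 0 < f2 -> 0 < f3 ->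
  0 < area_form p f0 f1 f2 f3).
{ intros f0 f1 f2 f3 h0 h1 h2 h3. unfold area_form.
  pose proof (tri_form_pos f0 f1 f2 h0 h1 h2). pose proof (tri_form_pos f0 f2 f3 h0 h2 h3).
  assert (0 < p * (1 - p) / 6) by (unfold Rdiv; apply Rmult_lt_0_compat; nra).
  assert (0 < p / 6) by lra.
  apply Rplus_lt_0_compat; apply Rmult_lt_0_compat; assumption. }
destruct hs as [[h0 [h1 [h2 h3]]] | [h0 [h1 [h2 h3]]]].
- apply hpos; assumption.
- unfold vtx0, vtx1, vtx2, vtx3 in *. rewrite afff_opp in h0, h1, h2, h3.
  rewrite <- area_form_opp. apply hpos; assumption.
Qed.

Definition tri_dir (x y z dx dy dz : R) :=
  - (dx * (/ x) ^ 2 + dy * (/ y) ^ 2 + dz * (/ z) ^ 2) * / x * / y * / z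
  - tri_form x y z * (dx * / x + dy * / y + dz * / z).

Definition bdry_dir (p f0 f1 f2 f3 d0 d1 d2 d3 : R) :=
  - p * / f0 * / f1 * (d0 * / f0 + d1 * / f1)
  - (1 - p) * / f1 * / f2 * (d1 * / f1 + d2 * / f2)
  - p * / f2 * / f3 * (d2 * / f2 + d3 * / f3)
  - / f3 * / f0 * (d3 * / f3 + d0 * / f0).

Definition area_dir (p f0 f1 f2 f3 d0 d1 d2 d3 : R) :=
  p * (1 - p) / 6 * tri_dir f0 f1 f2 d0 d1 d2 + p / 6 * tri_dir f0 f2 f3 d0 d2 d3.

Definition crit_form (p f0 f1 f2 f3 d0 d1 d2 d3 : R) :=
  2 * area_form p f0 f1 f2 f3 * bdry_dir p f0 f1 f2 f3 d0 d1 d2 d3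
  - bdry_form p f0 f1 f2 f3 * area_dir p f0 f1 f2 f3 d0 d1 d2 d3.

Lemma is_derive_bdry_form p f0 f1 f2 f3 d0 d1 d2 d3 :
  f0 <> 0 -> f1 <> 0 -> f2 <> 0 -> f3 <> 0 ->
  is_derive (fun t => bdry_form p (f0 + t * d0) (f1 + t * d1) (f2 + t * d2) (f3 + t * d3)) 0
    (bdry_dir p f0 f1 f2 f3 d0 d1 d2 d3).
Proof.
intros h0 h1 h2 h3. unfold bdry_form, bdry_dir.
auto_derive; rewrite ?Rmult_0_l, ?Rplus_0_r; [repeat split; auto | field; auto].
Qed.

Lemma is_derive_area_form p f0 f1 f2 f3 d0 d1 d2 d3 :
  f0 <> 0 -> f1 <> 0 -> f2 <> 0 -> f3 <> 0 ->
  is_derive (fun t => area_form p (f0 + t * d0) (f1 + t * d1) (f2 + t * d2) (f3 + t * d3)) 0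
    (area_dir p f0 f1 f2 f3 d0 d1 d2 d3).
Proof.
intros h0 h1 h2 h3. unfold area_form, area_dir, tri_dir, tri_form.
auto_derive; rewrite ?Rmult_0_l, ?Rplus_0_r; [repeat split; auto | field; auto].
Qed.

Lemma is_derive_scal_sqr_div (k : R) (B A : R -> R) (x dB dA : R) :
  is_derive B x dB -> is_derive A x dA -> A x <> 0 ->
  is_derive (fun t => k * B t ^ 2 / A t) x (k * B x * (2 * A x * dB - B x * dA) / A x ^ 2).
Proof.
intros hB hA hA0.
pose proof (is_derive_div _ _ x _ _ (is_derive_scal _ _ k _ (is_derive_pow B 2 x _ hB)) hA hA0)
  as hD.
replace (k * B x * (2 * A x * dB - B x * dA) / A x ^ 2)
  with ((k * (INR 2 * dB * B x ^ Nat.pred 2) * A x - k * B x ^ 2 * dA) / A x ^ 2)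
  by (simpl; field; auto).
exact hD.
Qed.

Lemma vertices_same_sign_near p a b c u v w : vertices_same_sign p a b c ->
  locally 0 (fun t => vertices_same_sign p (a + t * u) (b + t * v) (c + t * w)).
Proof.
intros [hpos | hneg].
- apply (filter_imp _ _ (fun t ht => or_introl ht)). now apply vertices_pos_near.
- apply (filter_imp (fun t => vertices_pos p (- a + t * - u) (- b + t * - v) (- c + t * - w))).
  + intros t ht. right. now replace (- (a + t * u)) with (- a + t * - u) by ring;
      replace (- (b + t * v)) with (- b + t * - v) by ring;
      replace (- (c + t * w)) with (- c + t * - w) by ring.
  + now apply vertices_pos_near.
Qed.

Lemma vertices_same_sign_neq0 p a b c : vertices_same_sign p a b c ->
  vtx0 a b c <> 0 /\ vtx1 p a b c <> 0 /\ vtx2 p a b c <> 0 /\ vtx3 a b c <> 0.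
Proof.
unfold vertices_same_sign, vertices_pos, vtx0, vtx1, vtx2, vtx3. rewrite !afff_opp. lra.
Qed.

Lemma vtx_line p a b c u v w t :
  vtx0 (a + t * u) (b + t * v) (c + t * w) = vtx0 a b c + t * vtx0 u v w /\
  vtx1 p (a + t * u) (b + t * v) (c + t * w) = vtx1 p a b c + t * vtx1 p u v w /\
  vtx2 p (a + t * u) (b + t * v) (c + t * w) = vtx2 p a b c + t * vtx2 p u v w /\
  vtx3 (a + t * u) (b + t * v) (c + t * w) = vtx3 a b c + t * vtx3 u v w.
Proof. unfold vtx0, vtx1, vtx2, vtx3, afff. repeat split; ring. Qed.

Lemma Ep_directional_derivative p a b c u v w : 0 < p < 1 -> vertices_same_sign p a b c ->
  is_derive (fun t => Ep p (a + t * u) (b + t * v) (c + t * w)) 0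
    (8 * PI ^ 2 * bdry_form p (vtx0 a b c) (vtx1 p a b c) (vtx2 p a b c) (vtx3 a b c)
     * crit_form p (vtx0 a b c) (vtx1 p a b c) (vtx2 p a b c) (vtx3 a b c)
                   (vtx0 u v w) (vtx1 p u v w) (vtx2 p u v w) (vtx3 u v w)
     / area_form p (vtx0 a b c) (vtx1 p a b c) (vtx2 p a b c) (vtx3 a b c) ^ 2).
Proof.
intros hp hs.
destruct (vertices_same_sign_neq0 p a b c hs) as [n0 [n1 [n2 n3]]].
pose proof (area_form_pos p a b c hp hs) as hA.
apply (is_derive_ext_loc (fun t => 8 * PI ^ 2
  * bdry_form p (vtx0 a b c + t * vtx0 u v w) (vtx1 p a b c + t * vtx1 p u v w)
      (vtx2 p a b c + t * vtx2 p u v w) (vtx3 a b c + t * vtx3 u v w) ^ 2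
  / area_form p (vtx0 a b c + t * vtx0 u v w) (vtx1 p a b c + t * vtx1 p u v w)
      (vtx2 p a b c + t * vtx2 p u v w) (vtx3 a b c + t * vtx3 u v w))).
- apply (filter_imp (fun t => vertices_same_sign p (a + t * u) (b + t * v) (c + t * w))).
  + intros t ht. rewrite (Ep_vertex_form p _ _ _ hp (admissible_of_same_sign p _ _ _ hp ht)).
    destruct (vtx_line p a b c u v w t) as [e0 [e1 [e2 e3]]].
    now rewrite e0, e1, e2, e3.
  + now apply vertices_same_sign_near.
- pose proof (is_derive_scal_sqr_div (8 * PI ^ 2) _ _ 0 _ _
    (is_derive_bdry_form p _ _ _ _ (vtx0 u v w) (vtx1 p u v w) (vtx2 p u v w) (vtx3 u v w)
       n0 n1 n2 n3)
    (is_derive_area_form p _ _ _ _ (vtx0 u v w) (vtx1 p u v w) (vtx2 p u v w) (vtx3 u v w)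
       n0 n1 n2 n3)) as hD.
  cbv beta in hD. rewrite !Rmult_0_l, !Rplus_0_r in hD.
  exact (hD (Rgt_not_eq _ _ hA)).
Qed.

Lemma crit_form_linear p f0 f1 f2 f3 u v w :
  crit_form p f0 f1 f2 f3 (vtx0 u v w) (vtx1 p u v w) (vtx2 p u v w) (vtx3 u v w)
  = u * crit_form p f0 f1 f2 f3 0 p p 0 + v * crit_form p f0 f1 f2 f3 0 0 (1 - p) 1
    + w * crit_form p f0 f1 f2 f3 1 1 1 1.
Proof.
unfold crit_form, bdry_dir, area_dir, tri_dir, vtx0, vtx1, vtx2, vtx3, afff. ring.
Qed.

Lemma crit_form_euler p f0 f1 f2 f3 : f0 <> 0 -> f1 <> 0 -> f2 <> 0 -> f3 <> 0 ->
  crit_form p f0 f1 f2 f3 f0 f1 f2 f3 = 0.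
Proof.
intros. unfold crit_form, bdry_form, area_form, bdry_dir, area_dir, tri_dir, tri_form.
field. auto.
Qed.

(* (0,p,p,0) and (0,0,1-p,1) are the vertex values of mu1 and mu2; the
   direction of the constants needs no check because of Euler's identity. *)
Lemma critical_point_of_vertex_values p a b c f0 f1 f2 f3 : 0 < p < 1 ->
  vtx0 a b c = f0 -> vtx1 p a b c = f1 -> vtx2 p a b c = f2 -> vtx3 a b c = f3 ->
  (0 < f0 /\ 0 < f1 /\ 0 < f2 /\ 0 < f3) \/ (f0 < 0 /\ f1 < 0 /\ f2 < 0 /\ f3 < 0) ->
  crit_form p f0 f1 f2 f3 0 p p 0 = 0 ->
  crit_form p f0 f1 f2 f3 0 0 (1 - p) 1 = 0 ->
  critical_point p a b c.
Proof.
intros hp <- <- <- <- hsign hmu1 hmu2.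
assert (hs : vertices_same_sign p a b c).
{ unfold vertices_same_sign, vertices_pos, vtx0, vtx1, vtx2, vtx3 in *.
  rewrite !afff_opp. lra. }
split; [exact (admissible_of_same_sign p a b c hp hs) |].
intros u v w. apply is_derive_Reals.
destruct (vertices_same_sign_neq0 p a b c hs) as [n0 [n1 [n2 n3]]].
assert (hconst : crit_form p (vtx0 a b c) (vtx1 p a b c) (vtx2 p a b c) (vtx3 a b c)
                   1 1 1 1 = 0).
{ pose proof (crit_form_euler p _ _ _ _ n0 n1 n2 n3) as e.
  rewrite crit_form_linear, hmu1, hmu2 in e.
  replace (vtx0 a b c) with c in n0 by (unfold vtx0, afff; ring).
  apply (Rmult_eq_reg_l c); [lra | assumption]. }
pose proof (Ep_directional_derivative p a b c u v w hp hs) as hD.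
rewrite crit_form_linear, hmu1, hmu2, hconst in hD.
replace 0 with (8 * PI ^ 2 * bdry_form p (vtx0 a b c) (vtx1 p a b c) (vtx2 p a b c) (vtx3 a b c)
  * (u * 0 + v * 0 + w * 0)
  / area_form p (vtx0 a b c) (vtx1 p a b c) (vtx2 p a b c) (vtx3 a b c) ^ 2) at 2
  by (unfold Rdiv; ring).
exact hD.
Qed.

Ltac crit_field :=
  unfold crit_form, bdry_form, area_form, bdry_dir, area_dir, tri_dir, tri_form; field.

Lemma critical_point_case1 p : 0 < p < 1 ->
  critical_point p 1 0 (p * (1 - sqrt (1 - p)) / (2 * sqrt (1 - p) + p - 2)).
Proof.
intros hp.
assert (hs0 : 0 < sqrt (1 - p)) by (apply sqrt_lt_R0; lra).
assert (hs2 : sqrt (1 - p) ^ 2 = 1 - p) by (apply pow2_sqrt; lra).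
set (s := sqrt (1 - p)) in *. clearbody s.
assert (ep : p = 1 - s ^ 2) by lra. subst p.
assert (hs1 : s < 1) by nra.
assert (hneq : 2 * s + (1 - s ^ 2) - 2 <> 0) by nra.
apply (critical_point_of_vertex_values _ _ _ _
  (- (1 + s)) (- (s * (1 + s))) (- (s * (1 + s))) (- (1 + s))).
- lra.
- unfold vtx0, afff. field. assumption.
- unfold vtx1, afff. field. assumption.
- unfold vtx2, afff. field. assumption.
- unfold vtx3, afff. field. assumption.
- right. repeat split; nra.
- crit_field. repeat split; nra.
- crit_field. repeat split; nra.
Qed.

Lemma critical_point_case2 p s : 8 / 9 < p < 1 -> s = 1 \/ s = -1 ->
  critical_point p (-1) 0
    (p * (3 * p + s * sqrt (9 * p ^ 2 - 8 * p)) / (2 * (p + s * sqrt (9 * p ^ 2 - 8 * p)))).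
Proof.
intros hp hs.
assert (hq2 : (s * sqrt (9 * p ^ 2 - 8 * p)) ^ 2 = 9 * p ^ 2 - 8 * p).
{ rewrite Rpow_mult_distr, pow2_sqrt by nra.
  destruct hs as [-> | ->]; ring. }
(* Writing s*sqrt(9p^2-8p) = p*r rationalizes the statement: p = 8/(9-r^2). *)
set (r := s * sqrt (9 * p ^ 2 - 8 * p) / p).
assert (er : s * sqrt (9 * p ^ 2 - 8 * p) = p * r) by (unfold r; field; lra).
rewrite er in hq2 |- *. clearbody r.
assert (ep : p = 8 / (9 - r ^ 2)).
{ assert (p * (9 - r ^ 2) = 8) by (apply (Rmult_eq_reg_l p); nra).
  field_simplify_eq; nra. }
assert (hr1 : r ^ 2 < 1) by nra.
clear hq2 er. subst p.
assert (h1r : 0 < 1 + r) by nra. assert (h1r' : 0 < 1 - r) by nra.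
assert (h9r : 0 < 9 - r ^ 2) by nra.
apply (critical_point_of_vertex_values _ _ _ _
  (4 / ((1 + r) * (3 - r))) (4 * (1 - r) / ((1 + r) * (9 - r ^ 2)))
  (4 * (1 - r) / ((1 + r) * (9 - r ^ 2))) (4 / ((1 + r) * (3 - r)))).
- lra.
- unfold vtx0, afff. field. repeat split; nra.
- unfold vtx1, afff. field. repeat split; nra.
- unfold vtx2, afff. field. repeat split; nra.
- unfold vtx3, afff. field. repeat split; nra.
- left. repeat split; apply Rdiv_lt_0_compat; nra.
- crit_field. repeat split; nra.
- crit_field. repeat split; nra.
Qed.

Lemma pow_SS_reduce (r F : R) (n : nat) : r ^ 2 = F -> r ^ S (S n) = F * r ^ n.
Proof. intros h. rewrite <- h. simpl. ring. Qed.

Lemma case3_vertex_products p r : r ^ 2 = Fpoly p ->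
  (p ^ 2 + 2 * p - 2 - r) * (p ^ 2 + 2 * p - 2 + r) = 8 * p * (1 - p) ^ 2 /\
  (p ^ 3 - 3 * p ^ 2 + 4 * p - 2 + (p - 1) * r) * (p ^ 3 - 3 * p ^ 2 + 4 * p - 2 - (p - 1) * r)
  = 8 * p * (1 - p) ^ 3.
Proof.
intros hr. split.
- transitivity ((p ^ 2 + 2 * p - 2) ^ 2 - r ^ 2); [ring |].
  rewrite hr. unfold Fpoly. ring.
- transitivity ((p ^ 3 - 3 * p ^ 2 + 4 * p - 2) ^ 2 - (p - 1) ^ 2 * r ^ 2); [ring |].
  rewrite hr. unfold Fpoly. ring.
Qed.

Lemma crit_form_case3 p r f0 f1 f2 f3 : 0 < p < 1 -> r ^ 2 = Fpoly p ->
  f0 = p ^ 2 + 2 * p - 2 - r -> f3 = p ^ 2 + 2 * p - 2 + r ->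
  f1 = p ^ 3 - 3 * p ^ 2 + 4 * p - 2 + (p - 1) * r ->
  f2 = p ^ 3 - 3 * p ^ 2 + 4 * p - 2 - (p - 1) * r ->
  crit_form p f0 f1 f2 f3 0 p p 0 = 0 /\ crit_form p f0 f1 f2 f3 0 0 (1 - p) 1 = 0.
Proof.
intros hp hr e0 e3 e1 e2.
destruct (case3_vertex_products p r hr) as [k03 k12].
rewrite <- e0, <- e3 in k03. rewrite <- e1, <- e2 in k12.
assert (q2 : 0 < 8 * p * (1 - p) ^ 2) by (apply Rmult_lt_0_compat; [lra | apply pow_lt; lra]).
assert (q3 : 0 < 8 * p * (1 - p) ^ 3) by (apply Rmult_lt_0_compat; [lra | apply pow_lt; lra]).
assert (n0 : f0 <> 0) by (intro h; rewrite h, Rmult_0_l in k03; lra).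
assert (n3 : f3 <> 0) by (intro h; rewrite h, Rmult_0_r in k03; lra).
assert (n1 : f1 <> 0) by (intro h; rewrite h, Rmult_0_l in k12; lra).
assert (n2 : f2 <> 0) by (intro h; rewrite h, Rmult_0_r in k12; lra).
set (k := / (8 * p * (1 - p) ^ 3)).
assert (kP : (1 - p) * k = / (8 * p * (1 - p) ^ 2)) by (unfold k; field; lra).
assert (i0 : / f0 = (1 - p) * k * f3) by (rewrite kP, <- k03; field; auto).
assert (i3 : / f3 = (1 - p) * k * f0) by (rewrite kP, <- k03; field; auto).
assert (i1 : / f1 = k * f2) by (unfold k; rewrite <- k12; field; auto).
assert (i2 : / f2 = k * f1) by (unfold k; rewrite <- k12; field; auto).
clearbody k.
unfold crit_form, area_form, bdry_form, area_dir, bdry_dir, tri_dir, tri_form, Rdiv.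
rewrite i0, i1, i2, i3. subst f0 f1 f2 f3.
(* Both sides are now polynomials in p, r, k; reduce modulo r^2 = F(p). *)
split; ring_simplify; repeat rewrite (pow_SS_reduce r (Fpoly p) _ hr); unfold Fpoly; ring.
Qed.

Lemma Fpoly_root_between x y : x <= y -> Fpoly x * Fpoly y <= 0 ->
  exists z, x <= z <= y /\ Fpoly z = 0.
Proof.
intros hxy hsign. destruct (IVT_cor Fpoly x y) as [z hz]; [unfold Fpoly; reg | auto | auto |].
now exists z.
Qed.

Section BelowFirstRoot.

Variables alpha beta : R.
Hypothesis halpha : 0 < alpha < beta.
Hypothesis hroots : forall x, Fpoly x = 0 -> x = alpha \/ x = beta.

Lemma first_root_le_half : alpha <= 1 / 2.
Proof.
destruct (Fpoly_root_between 0 (1 / 2)) as [z [hz hFz]]; [lra | unfold Fpoly; lra |].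
destruct (hroots z hFz); lra.
Qed.

Lemma Fpoly_pos_below_first_root p : 0 <= p < alpha -> 0 < Fpoly p.
Proof.
intros hp. apply Rnot_le_lt. intros hFp.
destruct (Fpoly_root_between 0 p) as [z [hz hFz]].
- lra.
- assert (0 < Fpoly 0) by (unfold Fpoly; lra). nra.
- destruct (hroots z hFz); lra.
Qed.

End BelowFirstRoot.

Lemma critical_point_case3 alpha beta p s :
  0 < alpha < beta -> (forall x, Fpoly x = 0 -> x = alpha \/ x = beta) ->
  0 < p < alpha -> s = 1 \/ s = -1 ->
  critical_point p
    (p ^ 2 - 4 * p + 2 + s * sqrt (Fpoly p))
    (s * 2 * sqrt (Fpoly p))
    (p ^ 2 + 2 * p - 2 - s * sqrt (Fpoly p)).
Proof.
intros halpha hroots hp hs.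
assert (hhalf := first_root_le_half alpha beta halpha hroots).
assert (hF := Fpoly_pos_below_first_root alpha beta halpha hroots p ltac:(lra)).
assert (hr : (s * sqrt (Fpoly p)) ^ 2 = Fpoly p).
{ rewrite Rpow_mult_distr, pow2_sqrt by lra. destruct hs as [-> | ->]; ring. }
replace (s * 2 * sqrt (Fpoly p)) with (2 * (s * sqrt (Fpoly p))) by ring.
set (r := s * sqrt (Fpoly p)) in *. clearbody r.
assert (hp1 : 0 < p < 1) by lra.
destruct (case3_vertex_products p r hr) as [k03 k12].
set (f0 := p ^ 2 + 2 * p - 2 - r) in *. set (f3 := p ^ 2 + 2 * p - 2 + r) in *.
set (f1 := p ^ 3 - 3 * p ^ 2 + 4 * p - 2 + (p - 1) * r) in *.
set (f2 := p ^ 3 - 3 * p ^ 2 + 4 * p - 2 - (p - 1) * r) in *.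
destruct (crit_form_case3 p r f0 f1 f2 f3 hp1 hr eq_refl eq_refl eq_refl eq_refl)
  as [hmu1 hmu2].
apply (critical_point_of_vertex_values _ _ _ _ f0 f1 f2 f3 hp1);
  try (unfold f0, f1, f2, f3, vtx0, vtx1, vtx2, vtx3, afff; ring); [| exact hmu1 | exact hmu2].
assert (neg_of_prod_sum : forall x y, 0 < x * y -> x + y < 0 -> x < 0 /\ y < 0)
  by (intros; nra).
assert (q2 : 0 < 8 * p * (1 - p) ^ 2) by (apply Rmult_lt_0_compat; [lra | apply pow_lt; lra]).
assert (q3 : 0 < 8 * p * (1 - p) ^ 3) by (apply Rmult_lt_0_compat; [lra | apply pow_lt; lra]).
destruct (neg_of_prod_sum f0 f3) as [h0 h3]; [lra | unfold f0, f3; nra |].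
destruct (neg_of_prod_sum f1 f2) as [h1 h2]; [lra | unfold f1, f2; nra |].
right. repeat split; assumption.
Qed.

Theorem mainTheorem5 :
  (forall p : R, 0 < p < 1 ->
     critical_point p 1 0
       (p * (1 - sqrt (1 - p)) / (2 * sqrt (1 - p) + p - 2)))
  /\
  (forall p : R, 8 / 9 < p < 1 ->
     forall s : R, (s = 1 \/ s = -1) ->
       critical_point p (-1) 0
         (p * (3 * p + s * sqrt (9 * p ^ 2 - 8 * p))
            / (2 * (p + s * sqrt (9 * p ^ 2 - 8 * p)))))
  /\
  (forall alpha beta : R,
     0 < alpha < beta /\ beta < 1 ->
     Fpoly alpha = 0 -> Fpoly beta = 0 ->
     (forall x : R, Fpoly x = 0 -> x = alpha \/ x = beta) ->
     forall p : R, 0 < p < alpha ->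
     forall s : R, (s = 1 \/ s = -1) ->
       critical_point p
         (p ^ 2 - 4 * p + 2 + s * sqrt (Fpoly p))
         (s * 2 * sqrt (Fpoly p))
         (p ^ 2 + 2 * p - 2 - s * sqrt (Fpoly p))).
Proof.
split; [| split].
- exact critical_point_case1.
- intros p hp s hs. exact (critical_point_case2 p s hp hs).
- intros alpha beta [halpha _] _ _ hroots p hp s hs.
  exact (critical_point_case3 alpha beta p s halpha hroots hp hs).
Qed.
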